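(* Let $d$ be a positive integer, let $V_1,\ldots,V_d$ be finite-dimensional real inner product spaces, and let $T\in V_1\otimes\cdots\otimes V_d$. Then $T$ is odeco if and only if for all $l=1,\ldots,d$ we have $$T *_l T\in\bigotimes_{j\neq l}\mathrm{Sym}_2(V_j).$$
   Context: Inner products are positive-definite. A tensor in $V_1\otimes\cdots\otimes V_d$ is called odeco if it can be written as $\sum_{i=1}^k v_{i1}\otimes\cdots\otimes v_{id}$ (with $k\ge0$), where for each $j$ the vectors $v_{1j},\ldots,v_{kj}$ are nonzero and pairwise orthogonal in $V_j$. For $T\in V_1\otimes\cdots\otimes V_d$ and $l\in\{1,\ldots,d\}$, the tensor $T*_l T\in\bigotimes_{j\ne l}(V_j\otimes V_j)$ is obtained by taking two copies of $T$, contracting them in their $l$-th components via the inner product $V_l\times V_l\to\mathbb{R}$, and regrouping the tensor factors so that, for each $j\neq l$, the $j$-th factor of the first copy is paired with the $j$-th factor of the second copy. That is, $(T,T')\mapsto T*_lT'$ is the bilinear map with $(x_1\otimes\cdots\otimes x_d)*_l(y_1\otimes\cdots\otimes y_d)=(x_l|y_l)\bigotimes_{j\ne l}(x_j\otimes y_j)$. $\mathrm{Sym}_2(V_j)\subseteq V_j\otimes V_j$ is the subspace of symmetric tensors. *)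

(* Defs.v *)
From HB Require Import structures.
From mathcomp Require Import all_boot all_order all_algebra.
From mathcomp Require Import boolp reals.

Set Implicit Arguments.
Unset Strict Implicit.
Unset Printing Implicit Defensive.

Import Order.TTheory GRing.Theory Num.Theory.
Local Open Scope ring_scope.

Definition multilinear (R : realType) (I : finType) (V : I -> vectType R)
    (W : lmodType R) (f : (forall i, V i) -> W) : Prop :=
  forall (x : forall i, V i) (i : I), linear (fun y : V i => f (dfwith x y)).

Definition bvec (R : realType) (V : vectType R) (k : 'I_(\dim {:V})) : V :=
  (vbasis {:V})`_k.

(* The tensor product of the V i in coordinates: one real coefficient for each
   choice of a vector of the basis bvec in every V i. Together with pure it has
   the universal property of the tensor product (tensor_universal), so the
   bases only serve to build a carrier. *)
Definition multi_index (R : realType) (I : finType) (V : I -> vectType R)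
  : finType := {dffun forall i : I, 'I_(\dim {:V i})}.

Definition tensor (R : realType) (I : finType) (V : I -> vectType R) :=
  {ffun multi_index V -> R^o}.

HB.instance Definition _ (R : realType) (I : finType) (V : I -> vectType R) :=
  Vector.on (tensor V).

Definition pure (R : realType) (I : finType) (V : I -> vectType R)
    (x : forall i, V i) : tensor V :=
  [ffun a : multi_index V => \prod_i coord (vbasis {:V i}) (a i) (x i)].

(* A binary tensor product, in the same coordinates (see tensor2_universal);
   the swap of the two factors is then matrix transposition (tr_pure2). *)
Definition tensor2 (R : realType) (V W : vectType R) : vectType R :=
  'M[R]_(\dim {:V}, \dim {:W}).

Definition pure2 (R : realType) (V W : vectType R) (x : V) (y : W)
  : tensor2 V W :=
  \matrix_(p, q) (coord (vbasis {:V}) p x * coord (vbasis {:W}) q y).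

Definition Sym2 (R : realType) (V : vectType R) : {vspace tensor2 V V} :=
  fixedSpace (linfun (trmx : 'M[R]_(\dim {:V}) -> 'M[R]_(\dim {:V}))).

Definition odeco (R : realType) (I : finType) (V : I -> vectType R)
    (ip : forall j, {dot (V j) for idfun}) (T : tensor V) : Prop :=
  exists (k : nat) (v : 'I_k -> forall j, V j),
    [/\ forall i j, v i j != 0,
        forall j i1 i2, i1 != i2 -> ip j (v i1 j) (v i2 j) = 0
      & T = \sum_(i < k) pure (v i)].

(* The tensor product of the subspaces U i inside that of the V i: the span of
   the pure tensors with factors in the U i. The coefficients c cannot be
   absorbed in the factors when I is empty. *)
Definition subtensor (R : realType) (I : finType) (V : I -> vectType R)
    (U : forall i, {vspace (V i)}) (S : tensor V) : Prop :=
  exists (k : nat) (c : 'I_k -> R) (u : 'I_k -> forall i, V i),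
    (forall m i, u m i \in U i) /\ S = \sum_(m < k) c m *: pure (u m).

(* T *_l T', extended bilinearly from its values on the pure tensors of basis
   vectors; star_pure gives its value on arbitrary pure tensors. *)
Definition star (R : realType) (I : finType) (V : I -> vectType R)
    (ip : forall j, {dot (V j) for idfun}) (l : I) (T T' : tensor V)
  : tensor (fun j : {j : I | j != l} => tensor2 (V (val j)) (V (val j))) :=
  \sum_(a : multi_index V) \sum_(b : multi_index V)
    (T a * T' b * ip l (bvec (a l)) (bvec (b l))) *:
      pure (fun j : {j : I | j != l} =>
              pure2 (bvec (a (val j))) (bvec (b (val j)))).

Section Theory.
Variable R : realType.

Lemma coord_bvec (V : vectType R) (p k : 'I_(\dim {:V})) :
  coord (vbasis {:V}) p (bvec k) = (p == k)%:R.
Proof. by rewrite coord_free ?(basis_free (vbasisP _)) // eq_sym. Qed.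

Lemma bvec_sum (V : vectType R) (x : V) :
  x = \sum_k coord (vbasis {:V}) k x *: bvec k.
Proof. exact: coord_vbasis (memvf x). Qed.

Lemma linear_sumZ (V W : lmodType R) (f : V -> W) (J : finType)
    (c : J -> R) (e : J -> V) : linear f ->
  f (\sum_j c j *: e j) = \sum_j c j *: f (e j).
Proof.
move=> fl; pose g : {linear V -> W} :=
  HB.pack f (GRing.isLinear.Build R V W *:%R f fl).
rewrite -[f]/(g : V -> W) linear_sum; apply: eq_bigr => j _; exact: linearZ.
Qed.

Section Family.
Variables (I : finType) (V : I -> vectType R).
Implicit Types (x : forall i, V i) (a : multi_index V).

Lemma dfwith_id x i : dfwith x (x i) = x.
Proof.
by apply: functional_extensionality_dep => j; case: dfwithP => // k.
Qed.

Lemma multilinear_eq (W : lmodType R) (f g : (forall i, V i) -> W) :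
  multilinear f -> multilinear g ->
  (forall a, f (fun i => bvec (a i)) = g (fun i => bvec (a i))) ->
  forall x, f x = g x.
Proof.
move=> fl gl fg.
suff H (s : seq I) x : (forall i, i \notin s -> exists k, x i = bvec k) ->
    f x = g x by move=> x; apply: (H (enum I)) => i; rewrite mem_enum.
elim: s x => [|i s IHs] x xP.
  have /fin_all_exists [a aP] i : exists k, x i = bvec k by exact: xP.
  pose a' : multi_index V := [ffun i => a i].
  suff -> : x = fun i => bvec (a' i) by [].
  by apply: functional_extensionality_dep => i; rewrite ffunE.
rewrite -(dfwith_id x i) (bvec_sum (x i)).
rewrite (linear_sumZ _ _ (fl x i)) (linear_sumZ _ _ (gl x i)).
apply: eq_bigr => k _; congr (_ *: _); apply: IHs => j js.
have [ij|ij] := eqVneq i j; first by subst j; exists k; rewrite dfwith_in.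
rewrite dfwith_out //; apply: xP; rewrite inE negb_or js andbT.
by rewrite eq_sym.
Qed.

Lemma pure_multilinear : multilinear (@pure R I V).
Proof.
move=> x i c y z; apply/ffunP => a; rewrite !ffunE.
rewrite !(bigD1 i (P := predT)) //= !dfwith_in linearP mulrDl.
rewrite -mulrA; congr (c * (_ * _) + _ * _);
  by apply: eq_bigr => j ji; rewrite !dfwith_out // eq_sym.
Qed.

Lemma pure_bvec a b : pure (fun i => bvec (a i)) b = (b == a)%:R.
Proof.
rewrite ffunE; under eq_bigr do rewrite coord_bvec.
have [->|ba] := eqVneq b a; first by rewrite big1 // => i _; rewrite eqxx.
have [i /negPf bai] : exists i, b i != a i.
  by apply/existsP; rewrite -negb_forall; apply: contra ba => /eqfunP/ffunP->.
by rewrite (bigD1 i) //= bai mul0r.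
Qed.

Lemma tensor_sum (T : tensor V) :
  T = \sum_(a : multi_index V) T a *: pure (fun i => bvec (a i)).
Proof.
apply/ffunP => b; rewrite sum_ffunE (bigD1 b) //= big1 => [|a ab].
  by rewrite ffunE pure_bvec eqxx addr0 /GRing.scale /= mulr1.
by rewrite ffunE pure_bvec eq_sym (negPf ab) scaler0.
Qed.

Lemma tensor_universal (W : lmodType R) (f : (forall i, V i) -> W) :
  multilinear f ->
  exists2 g : {linear tensor V -> W}, (forall x, g (pure x) = f x)
    & forall h : {linear tensor V -> W}, (forall x, h (pure x) = f x) -> h =1 g.
Proof.
move=> fl; pose g (T : tensor V) : W :=
  \sum_(a : multi_index V) T a *: f (fun i => bvec (a i)).
have gl : linear g.
  move=> c S T; rewrite scaler_sumr -big_split; apply: eq_bigr => a _ /=.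
  by rewrite !ffunE scalerDl -scalerA.
pose g' : {linear tensor V -> W} :=
  HB.pack g (GRing.isLinear.Build R (tensor V) W *:%R g gl).
exists g' => [x|h hP T].
  apply: (multilinear_eq (f := g' \o @pure R I V)) => //.
    by move=> y i c u v; rewrite /= pure_multilinear; exact: gl.
  move=> a /=; rewrite /g (bigD1 a) //= pure_bvec eqxx scale1r.
  by rewrite big1 ?addr0 // => b /negPf ba; rewrite pure_bvec ba scale0r.
rewrite {1}(tensor_sum T) linear_sum; apply: eq_bigr => a _.
by rewrite linearZ hP.
Qed.
End Family.

Section Binary.
Variables V W : vectType R.

Lemma pure2_linearl (y : W) : linear (fun x : V => pure2 x y).
Proof.
by move=> c x z; apply/matrixP => p q; rewrite !mxE linearP mulrDl mulrA. Qed.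

Lemma pure2_linearr (x : V) : linear (fun y : W => pure2 x y).
Proof.
by move=> c y z; apply/matrixP => p q; rewrite !mxE linearP mulrDr mulrCA. Qed.

Lemma tr_pure2 (x : V) (y : W) : (pure2 x y)^T = pure2 y x.
Proof. by apply/matrixP => p q; rewrite !mxE mulrC. Qed.

Lemma pure2_bvec p q : pure2 (bvec p : V) (bvec q : W) = delta_mx p q.
Proof. by apply/matrixP => i j; rewrite !mxE !coord_bvec -natrM mulnb. Qed.

Lemma tensor2_universal (U : lmodType R) (f : V -> W -> U) :
  (forall y, linear (f^~ y)) -> (forall x, linear (f x)) ->
  exists2 g : {linear tensor2 V W -> U}, (forall x y, g (pure2 x y) = f x y)
    & forall h : {linear tensor2 V W -> U},
        (forall x y, h (pure2 x y) = f x y) -> h =1 g.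
Proof.
move=> fl fr; pose g (A : tensor2 V W) : U :=
  \sum_p \sum_q (A : 'M_(_, _)) p q *: f (bvec p) (bvec q).
have gl : linear g.
  move=> c A B; rewrite scaler_sumr -big_split; apply: eq_bigr => p _ /=.
  rewrite scaler_sumr -big_split; apply: eq_bigr => q _ /=.
  by rewrite !mxE scalerDl -scalerA.
pose g' : {linear tensor2 V W -> U} :=
  HB.pack g (GRing.isLinear.Build R (tensor2 V W) U *:%R g gl).
exists g' => [x y|h hP A].
  rewrite {2}(bvec_sum x) (linear_sumZ _ _ (fl y)) /= /g.
  apply: eq_bigr => p _; rewrite {2}(bvec_sum y) (linear_sumZ _ _ (fr _)).
  by rewrite scaler_sumr; apply: eq_bigr => q _; rewrite mxE scalerA.
rewrite {1}[A]matrix_sum_delta linear_sum; apply: eq_bigr => p _.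
by rewrite linear_sum; apply: eq_bigr => q _; rewrite linearZ -pure2_bvec hP.
Qed.
End Binary.

Lemma Sym2P (V : vectType R) (A : tensor2 V V) :
  reflect ((A : 'M_(\dim {:V}))^T = A) (A \in Sym2 V).
Proof. by apply: (iffP fixedSpaceP); rewrite lfunE. Qed.

Section Star.
Variables (I : finType) (V : I -> vectType R).
Variables (ip : forall j, {dot (V j) for idfun}) (l : I).

Lemma star_linearl (T' : tensor V) : linear (fun T => star ip l T T').
Proof.
move=> c S T; rewrite scaler_sumr -big_split; apply: eq_bigr => a _ /=.
rewrite scaler_sumr -big_split; apply: eq_bigr => b _ /=.
by rewrite !ffunE scalerA -scalerDl !mulrDl !mulrA.
Qed.

Lemma star_linearr (T : tensor V) : linear (fun T' => star ip l T T').
Proof.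
move=> c S T'; rewrite scaler_sumr -big_split; apply: eq_bigr => a _ /=.
rewrite scaler_sumr -big_split; apply: eq_bigr => b _ /=.
rewrite !ffunE scalerA -scalerDl !mulrDr !mulrDl !mulrA.
by rewrite [T a * c]mulrC.
Qed.

Let J := {j : I | j != l}.

Let pair_multilinear (c : V l -> R)
    (W : forall j : J, V (val j) -> tensor2 (V (val j)) (V (val j))) :
  scalar c -> (forall j, linear (W j)) ->
  multilinear (fun x : forall i, V i =>
    c (x l) *: pure (fun j : J => W j (x (val j)))).
Proof.
move=> cl Wl x i; have [il|il] := eqVneq i l.
  subst i => k y z; rewrite !dfwith_in cl scalerDl -scalerA.
  have E (u : V l) : (fun j : J => W j (dfwith x u (val j))) =
                     fun j => W j (x (val j)).
    apply: functional_extensionality_dep => j; rewrite dfwith_out //.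
    by rewrite eq_sym; exact: (valP j).
  by rewrite !E.
pose i' : J := exist _ i il.
have E (u : V i) : (fun j : J => W j (dfwith x u (val j))) =
    dfwith (T := fun j : J => tensor2 (V (val j)) (V (val j)))
           (fun j => W j (x (val j))) (W i' u).
  apply: functional_extensionality_dep => j.
  have [<-|ij] := eqVneq i' j.
    by rewrite [RHS]dfwith_in; congr (W _ _); exact: dfwith_in.
  by rewrite [RHS]dfwith_out //; congr (W _ _); exact: dfwith_out.
move=> k y z; rewrite !dfwith_out // !E.
rewrite (Wl i') pure_multilinear scalerDr !scalerA.
by rewrite [c _ * k]mulrC.
Qed.

Lemma star_pure (x y : forall i, V i) :
  star ip l (pure x) (pure y) =
  ip l (x l) (y l) *: pure (fun j : {j : I | j != l} =>
                              pure2 (x (val j)) (y (val j))).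
Proof.
move: x; apply: multilinear_eq => [x i c u v||a] /=.
- by rewrite pure_multilinear star_linearl.
- apply: (pair_multilinear (c := fun u => ip l u (y l))
            (W := fun j u => pure2 u (y (val j)))) => [c u v|j].
    exact: linearPl.
  exact: pure2_linearl.
move: y; apply: multilinear_eq => [x i c u v||b] /=.
- by rewrite pure_multilinear star_linearr.
- apply: (pair_multilinear (c := fun u => ip l (bvec (a l)) u)
            (W := fun j u => pure2 (bvec (a (val j))) u)) => [c u v|j].
    by rewrite linearPr.
  exact: pure2_linearr.
rewrite /star (bigD1 a) //= [X in _ + X]big1 ?addr0 => [|a' aa'].
  rewrite (bigD1 b) //= [X in _ + X]big1 ?addr0 => [|b' bb'].
    by rewrite !pure_bvec !eqxx !mul1r.
  by rewrite !pure_bvec (negPf bb') mulr0 mul0r scale0r.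
by rewrite big1 // => b' _; rewrite !pure_bvec (negPf aa') !mul0r scale0r.
Qed.
End Star.
End Theory.

(* Main.v *)
(* Let tau be the multilinear form attached to T and let C_l(x) in V_l represent
   the linear form obtained from tau by fixing the x_i with i != l. The condition
   on T *_l T says that <C_l(x), C_l(y)> does not change when x_j and y_j are
   exchanged, for any j != l. For p != q the operators v |-> C_p(x[q := v]) then
   form a family of maps A from V_q to V_p such that all A^T A' and all A A'^T are
   symmetric; hence the A^T A' commute, and a common orthogonal eigenbasis of
   V_q gives a simultaneous singular value decomposition: tau(z) is a sum of
   terms <u_i, z_q> <w_i, z_p> rho_i(z) with orthogonal u_i, orthogonal w_i and
   rho_i independent of z_p and z_q. The exchange property for l = p makes every
   rho_i a product of linear forms, and for l outside {p, q} it makes the vectors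
   that represent these forms orthogonal. *)
From HB Require Import structures.
Require Import Defs.
From mathcomp Require Import all_boot all_order all_algebra.
From mathcomp Require Import complex ring.
From mathcomp Require Import boolp reals.

Set Implicit Arguments.
Unset Strict Implicit.
Unset Printing Implicit Defensive.

Import Order.TTheory GRing.Theory Num.Theory.
Local Open Scope ring_scope.

(** * Common orthogonal eigenbases of commuting self-adjoint operators *)

Section RealEigenvectors.
Variable R : rcfType.

(* x + iy is an eigenvector of S for the eigenvalue a + ib. *)
Lemma complex_eigenvector (V : vectType R) (W : {vspace V}) (S : 'End(V)) :
  W != 0%VS -> (S @: W <= W)%VS ->
  exists (a b : R) (x y : V), [/\ x \in W, y \in W, (x != 0) || (y != 0),
    S x = a *: x - b *: y & S y = b *: x + a *: y].
Proof.
move=> W0 SW; set n := \dim W; pose e := vbasis W.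
have n0 : (0 < n)%N by rewrite lt0n dimv_eq0.
have ef : free e by exact: basis_free (vbasisP W).
pose M : 'M[R]_n := \matrix_(i, j) coord e j (S e`_i).
pose toC := real_complex R.
have [l /eigenvalueP [z zM z0]] := eigenvalue_closed (map_mx toC M) n0.
have zE j : \sum_i z 0 i * toC (M i j) = l * z 0 j.
  by move/rowP/(_ j): zM; rewrite !mxE => <-; apply: eq_bigr => i _; rewrite !mxE.
(* Row i of [M] holds the coordinates of S e_i, so the row eigenvector [z] lists the coordinates of
   an eigenvector of the complexified S. Taking [f] to be Re or Im gives its real and imaginary
   parts. *)
pose v (f : R[i] -> R) : V := \sum_i f (z 0 i) *: e`_i.
have vW f : v f \in W.
  by apply: memv_suml => i _; rewrite memvZ // vbasis_mem // mem_nth ?size_tuple.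
have Sv f : S (v f) = \sum_j (\sum_i f (z 0 i) * M i j) *: e`_j.
  rewrite linear_sum; under [RHS]eq_bigr do rewrite scaler_suml.
  rewrite exchange_big; apply: eq_bigr => i _ /=.
  have eiW : S e`_i \in W.
    apply: (subvP SW); apply: memv_img.
    by rewrite vbasis_mem // mem_nth ?size_tuple.
  rewrite linearZ /= (coord_vbasis eiW).
  by rewrite scaler_sumr; apply: eq_bigr => j _; rewrite scalerA mxE.
have ReS j : \sum_i complex.Re (z 0 i) * M i j =
    complex.Re l * complex.Re (z 0 j) - complex.Im l * complex.Im (z 0 j).
  have /(congr1 (@complex.Re R)) := zE j.
  rewrite (big_morph (@complex.Re R) (id1 := 0) (op1 := +%R)) //; last by case=> ??[].
  case: l {zM zE} (z 0 j) => la lb [ca cb] /= <-.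
  by apply: eq_bigr => i _; case: (z 0 i) => p q /=; rewrite mulr0 subr0.
have ImS j : \sum_i complex.Im (z 0 i) * M i j =
    complex.Im l * complex.Re (z 0 j) + complex.Re l * complex.Im (z 0 j).
  have /(congr1 (@complex.Im R)) := zE j.
  rewrite (big_morph (@complex.Im R) (id1 := 0) (op1 := +%R)) //; last by case=> ??[].
  case: l {zM zE ReS} (z 0 j) => la lb [ca cb] /=; rewrite [RHS]addrC => <-.
  by apply: eq_bigr => i _; case: (z 0 i) => p q /=; rewrite mulr0 add0r.
exists (complex.Re l), (complex.Im l), (v (@complex.Re R)), (v (@complex.Im R)).
split => //; first 1 last.
- rewrite Sv !scaler_sumr -sumrB; apply: eq_bigr => j _.
  by rewrite ReS !scalerA scalerBl.
- rewrite Sv !scaler_sumr -big_split; apply: eq_bigr => j _ /=.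
  by rewrite ImS !scalerA scalerDl.
rewrite -negb_and; apply: contra z0 => /andP[/eqP x0 /eqP y0].
apply/eqP/rowP => i; rewrite mxE; apply/eqP; rewrite eq_complex.
by rewrite (elimT freeP ef _ x0 i) (elimT freeP ef _ y0 i) !eqxx.
Qed.

Lemma memv_lker_subZ (V : vectType R) (S : 'End(V)) a v :
  (v \in lker (S - a *: \1%VF)) = (S v == a *: v).
Proof. by rewrite memv_ker add_lfunE opp_lfunE scale_lfunE id_lfunE subr_eq0. Qed.

Variables (V : vectType R) (ip : {dot V for idfun}).

Lemma dotC (x y : V) : ip x y = ip y x.
Proof. by rewrite hermC mul1r. Qed.

Lemma dot_eq0 (x : V) : (ip x x == 0) = (x == 0).
Proof.
apply/idP/eqP => [|->]; last by rewrite linear0r.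
by apply: contraTeq => /(neq0_dnorm_gt0 (s := ip)); case: ltgtP.
Qed.

Lemma dot_ge0 (x : V) : 0 <= ip x x.
Proof.
have [->|/(neq0_dnorm_gt0 (s := ip))/ltW //] := eqVneq x 0.
by rewrite linear0r.
Qed.

Lemma dot_inj (x y : V) : (forall z, ip x z = ip y z) -> x = y.
Proof.
move=> xy; apply/eqP; rewrite -subr_eq0 -dot_eq0.
by rewrite linearBl /= xy subrr.
Qed.

Definition selfadjoint (S : 'End(V)) := forall x y, ip (S x) y = ip x (S y).

(** For a complex eigenvector x + iy with eigenvalue a + ib, comparing (S x | y) with (x | S y)
    gives b (|x|^2 + |y|^2) = 0. Hence b = 0, and whichever of x and y is nonzero is a real
    eigenvector. *)
Lemma selfadjoint_eigenvector (W : {vspace V}) (S : 'End(V)) :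
  selfadjoint S -> W != 0%VS -> (S @: W <= W)%VS ->
  exists a, (W :&: lker (S - a *: \1%VF))%VS != 0%VS.
Proof.
move=> sS W0 /(complex_eigenvector W0)[a [b [x [y [xW yW xy0 Sx Sy]]]]].
have : b * (ip x x + ip y y) = 0.
  have := sS x y; rewrite Sx Sy linearBl linearDr !linearZl_LR !linearZr_LR /=.
  by rewrite addrC => /addIr/eqP; rewrite eq_sym -subr_eq0 opprK -mulrDr => /eqP.
move/eqP; rewrite mulf_eq0 paddr_eq0 ?dot_ge0 // !dot_eq0.
have [b0 _|_ /=] := eqVneq b 0; last by rewrite -[_ && _]negbK negb_and xy0.
exists a; move: Sx Sy; rewrite b0 !scale0r subr0 add0r => Sx Sy.
have E (z : V) : z \in W -> S z = a *: z -> z != 0 ->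
    (W :&: lker (S - a *: \1%VF))%VS != 0%VS.
  move=> zW Sz; apply: contra => /eqP K.
  by rewrite -memv0 -K memv_cap zW memv_lker_subZ Sz eqxx.
by case/orP: xy0; [apply: E xW Sx|apply: E yW Sy].
Qed.

Variables (X : Type) (S : X -> 'End(V)).
Hypothesis S_selfadjoint : forall x, selfadjoint (S x).
Hypothesis S_comm : forall x y v, S x (S y v) = S y (S x v).

(** Induction on the dimension. If some [S x] is not a scalar on W, one of its eigenspaces in W is
    nonzero, proper and, by commutativity, stable under the whole family. Otherwise every nonzero
    vector of W will do. *)
Lemma common_eigenvector_stable (W : {vspace V}) :
  W != 0%VS -> (forall x, (S x @: W <= W)%VS) ->
  exists u, [/\ u \in W, u != 0 & forall x, exists a, S x u = a *: u].
Proof.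
have [n] := ubnP (\dim W); elim: n W => // n IHn W leWn W0 SW.
have [[x Sx]|noS] :=
  pselect (exists x, forall a, ~~ (W <= lker (S x - a *: \1%VF))%VS).
  have [a Wa0] := selfadjoint_eigenvector (S_selfadjoint x) W0 (SW x).
  set Wa := (_ :&: _)%VS in Wa0.
  have [||y|u [uWa u0 Su]] := IHn Wa; last 1 first.
  - by exists u; split=> //; move: uWa; rewrite memv_cap => /andP[].
  - rewrite ltnS in leWn; apply: leq_trans leWn; rewrite ltnNge; apply/negP => leW.
    have /eqP WaW : Wa == W by rewrite eqEdim capvSl.
    by have /negP := Sx a; apply; rewrite -WaW capvSr.
  - exact: Wa0.
  apply/subvP => _ /memv_imgP[w + ->]; rewrite !memv_cap => /andP[wW].
  rewrite !memv_lker_subZ => /eqP wE.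
  rewrite (subvP (SW y)) ?memv_img //=.
  by rewrite S_comm wE linearZ eqxx.
have u0 : vpick W != 0 by rewrite vpick0.
exists (vpick W); split=> // [|x]; first exact: memv_pick.
have [//|noa] := pselect (exists a, S x (vpick W) = a *: vpick W).
case: noS; exists x => a; apply/negP => /subvP/(_ _ (memv_pick W)).
rewrite memv_lker_subZ => /eqP E.
by apply: noa; exists a.
Qed.

Definition eigen_system (s : seq V) :=
  [/\ uniq s, 0 \notin s,
      {in s &, forall u v, u != v -> ip u v = 0}
    & {in s, forall u x, exists a, S x u = a *: u}].

(** Split off a common eigenvector u. Self-adjointness makes the orthogonal complement of u in W
    stable, and the induction continues there. *)
Lemma orthogonal_eigenbasis_stable (W : {vspace V}) :
  (forall x, (S x @: W <= W)%VS) ->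
  exists s, [/\ eigen_system s, {subset s <= W} &
    {in W, forall w, w = \sum_(u <- s) (ip u w / ip u u) *: u}].
Proof.
have [n] := ubnP (\dim W); elim: n W => // n IHn W leWn SW.
have [->|W0] := eqVneq W 0%VS.
  exists [::]; split=> // w; rewrite big_nil memv0; exact: eqP.
have [u [uW u0 Su]] := common_eigenvector_stable W0 SW.
pose W' := (W :&: orthov ip <[u]>)%VS.
have W'P w : (w \in W') = (w \in W) && (ip u w == 0).
  by rewrite memv_cap mem_orthov1 dotC.
have [||s [[s_uniq s0 s_orth s_eig] sW' sE]] := IHn W'.
- rewrite ltnS in leWn; apply: leq_trans leWn; rewrite ltnNge; apply/negP => leW.
  have /eqP W'W : W' == W by rewrite eqEdim capvSl.
  by move: uW; rewrite -W'W W'P dot_eq0 (negPf u0) andbF.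
- move=> x; apply/subvP => _ /memv_imgP[w + ->]; rewrite !W'P => /andP[wW /eqP uw].
  rewrite (subvP (SW x)) ?memv_img //= -S_selfadjoint.
  by have [a ->] := Su x; rewrite linearZl_LR /= uw mulr0.
have us v : v \in s -> ip u v = 0.
  by move/sW'; rewrite W'P => /andP[_ /eqP].
exists (u :: s); split.
- split.
  + rewrite /= s_uniq andbT; apply/negP => /us/eqP.
    by rewrite dot_eq0 (negPf u0).
  + by rewrite inE eq_sym (negPf u0).
  + move=> v w; rewrite !inE => /predU1P[->|vs] /predU1P[->|ws] vw.
    * by rewrite eqxx in vw.
    * exact: us.
    * by rewrite dotC us.
    * exact: s_orth.
  + by move=> v; rewrite inE => /predU1P[->//|]; exact: s_eig.
- move=> v; rewrite inE => /predU1P[->//|/sW'].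
  by rewrite W'P => /andP[].
move=> w wW; rewrite big_cons.
set c := _ / _; have w'W' : w - c *: u \in W'.
  rewrite W'P memvB ?memvZ //= linearBr linearZr_LR /=.
  by rewrite /c divfK ?subrr // dot_eq0.
rewrite -[LHS](subrK (c *: u)) addrC; congr (_ + _).
rewrite {1}(sE _ w'W'); apply: eq_big_seq => v vs.
by rewrite linearBr linearZr_LR /= (dotC v u) us // mulr0 subr0.
Qed.

Lemma orthogonal_eigenbasis : exists s, eigen_system s /\
  forall w, w = \sum_(u <- s) (ip u w / ip u u) *: u.
Proof.
have [|s [s_eig _ sE]] := @orthogonal_eigenbasis_stable fullv.
  by move=> x; apply: subvf.
by exists s; split=> // w; apply: sE; apply: memvf.
Qed.
End RealEigenvectors.

(** The empty family of operators, indexed by [void], already yields an orthogonal basis of V; the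
    representing vector is written in it. *)
Lemma riesz (R : rcfType) (V : vectType R) (ip : {dot V for idfun})
    (f : {linear V -> R^o}) : exists r, forall x, ip r x = f x.
Proof.
have [||s [_ sE]] := @orthogonal_eigenbasis R V ip void (fun=> 0).
- by case.
- by case.
exists (\sum_(u <- s) (f u / ip u u) *: u) => x.
rewrite linear_sumlz [in RHS](sE x) linear_sum; apply: eq_bigr => u _.
rewrite linearZl_LR linearZ /= mulrAC [RHS]mulrAC; congr (_ / _).
exact: mulrC.
Qed.

(** * Simultaneous singular value decomposition *)

Section SimultaneousSVD.
Variables (R : rcfType) (V W : vectType R).
Variables (ipV : {dot V for idfun}) (ipW : {dot W for idfun}).
Variables (X : Type) (A : X -> 'Hom(V, W)) (B : X -> 'Hom(W, V)).
Hypothesis adjAB : forall x v w, ipW (A x v) w = ipV v (B x w).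
Hypothesis AB : forall x y w, A x (B y w) = A y (B x w).
Hypothesis BA : forall x y v, B x (A y v) = B y (A x v).

(** By [adjAB], [AB] and [BA] the products B x A y are self-adjoint and commute. The u_i come from a
    common orthogonal eigenbasis, and each w_i is a nonzero image of u_i. Images of distinct u_i are
    orthogonal, since moving A across the inner product leaves some B x A y, which only rescales its
    eigenvector. *)
Lemma simultaneous_svd : exists (k : nat) (u : 'I_k -> V) (w : 'I_k -> W),
  [/\ forall i, u i != 0,
      forall i i', i != i' -> ipV (u i) (u i') = 0,
      forall i i', i != i' -> ipW (w i) (w i') = 0
    & forall i, exists x, A x (u i) != 0] /\
  (forall i x, exists c, A x (u i) = c *: w i) /\
  (forall x v, A x v = \sum_i (ipV (u i) v / ipV (u i) (u i)) *: A x (u i)).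
Proof.
pose S (z : X * X) := (B z.1 \o A z.2)%VF.
have SE z v : S z v = B z.1 (A z.2 v) by rewrite lfunE.
have S_sa z : selfadjoint ipV (S z).
  by move=> v v'; rewrite !SE BA dotC -adjAB dotC adjAB.
have S_comm z z' v : S z (S z' v) = S z' (S z v).
  case: z z' => [x y] [x' y']; rewrite !SE /=.
  by rewrite (AB y) (BA x x') (BA y) (AB x y').
have [s [[s_uniq s0 s_orth s_eig] sE]] := orthogonal_eigenbasis S_sa S_comm.
(* Basis vectors killed by every [A x] contribute nothing to the expansion and are discarded. *)
pose nz u := `[<exists x, A x u != 0>].
pose s' := [seq u <- s | nz u].
have s's u : u \in s' -> u \in s by rewrite mem_filter => /andP[].
pose u (i : 'I_(size s')) : V := tnth (in_tuple s') i.
have us i : u i \in s by apply: s's; apply: mem_tnth.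
have uA i : exists x, A x (u i) != 0.
  by have := mem_tnth i (in_tuple s'); rewrite mem_filter => /andP[/asboolP].
have u_neq i i' : i != i' -> u i != u i'.
  apply: contra => /eqP uu; apply/eqP/(tuple_uniqP (in_tuple s') _) => //=.
  exact: filter_uniq.
have [xs xsP] := choice uA.
pose w i := A (xs i) (u i).
have eig i x y : exists c, B x (A y (u i)) = c *: u i.
  by have [c] := s_eig _ (us i) (x, y); rewrite SE; exists c.
exists (size s'), u, w; split; last split.
- split=> //.
  + by move=> i; apply: contraNneq s0 => <-.
  + by move=> i i' /u_neq; apply: s_orth.
  + move=> i i' /u_neq ii'; rewrite adjAB; have [c ->] := eig i' (xs i) (xs i').
    by rewrite linearZr_LR /= s_orth // mulr0.
(* A x (u i) is proportional to w i: evaluate A (xs i) B (xs i) A x (u i) in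
   two ways. *)
- move=> i x; have [m mE] := eig i (xs i) (xs i).
  have [n nE] := eig i (xs i) x.
  have m0 : m != 0.
    apply: contra (xsP i) => /eqP m0.
    by rewrite -(dot_eq0 ipW) adjAB mE m0 scale0r linear0r.
  exists (n / m); apply: (scalerI m0); rewrite scalerA mulrCA divff // mulr1.
  by rewrite -!linearZ -mE -nE /= AB BA AB.
move=> x v; rewrite {1}(sE v) linear_sum.
under eq_bigr do rewrite linearZ /=.
rewrite -(big_tnth _ _ s' xpredT (fun u => (ipV u v / ipV u u) *: A x u)).
rewrite big_filter [RHS]big_mkcond; apply: eq_bigr => z _.
rewrite /nz; case: asboolP => // nA; have [->|Az] := eqVneq (A x z) 0.
  exact: scaler0.
by case: nA; exists x.
Qed.
End SimultaneousSVD.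

(** * Replacing single components, and factorization by exchange *)

Section DfWith.
Variables (I : eqType) (V : I -> Type).
Implicit Types x : forall i, V i.

Lemma dfwith_twice x i (u v : V i) : dfwith (dfwith x u) v = dfwith x v.
Proof.
apply: functional_extensionality_dep => k; case: (dfwithP _ v) => [|k' ik].
  by rewrite dfwith_in.
by rewrite !dfwith_out.
Qed.

Lemma dfwithC x i j (u : V i) (v : V j) : i != j ->
  dfwith (dfwith x u) v = dfwith (dfwith x v) u.
Proof.
move=> ij; apply: functional_extensionality_dep => k.
have [<-|jk] := eqVneq j k.
  by rewrite dfwith_in dfwith_out // dfwith_in.
rewrite dfwith_out //; have [<-|ik] := eqVneq i k; first by rewrite !dfwith_in.
by rewrite !dfwith_out.
Qed.
End DfWith.

(** Turn y into x one component at a time: with m agreeing with y at i, and m' equal to m except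
    that it has x_i there, exchanging component i between m' and y gives f m' * f y = f m * f (y
    with x_i). So each change multiplies the value by one factor of the product. *)
Lemma exchange_factorization (R : fieldType) (I : finType) (V : I -> Type)
    (f : (forall i, V i) -> R) (y : forall i, V i) :
  (forall x z j, f x * f z = f (dfwith x (z j)) * f (dfwith z (x j))) ->
  f y != 0 ->
  forall x, f x = f y * \prod_j (f (dfwith y (x j)) / f y).
Proof.
move=> fE fy0 x; pose mix (s : seq I) i := if i \in s then x i else y i.
suff mixE s : uniq s ->
    f (mix s) = f y * \prod_(j <- s) (f (dfwith y (x j)) / f y).
  have -> : x = mix (index_enum I).
    by apply: functional_extensionality_dep => i; rewrite /mix mem_index_enum.
  rewrite mixE ?index_enum_uniq //; congr (_ * _); apply: eq_bigr => j _.
  by rewrite /mix mem_index_enum.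
elim: s => [_|i s IHs /= /andP[is_ s_uniq]].
  have -> : mix [::] = y by apply: functional_extensionality_dep.
  by rewrite big_nil mulr1.
rewrite big_cons mulrCA -IHs // mulrAC; apply: (mulIf fy0); rewrite divfK //.
rewrite (fE _ _ i) [RHS]mulrC; congr (f _ * f _).
  apply: functional_extensionality_dep => k; case: dfwithP => [|k' ik].
    by rewrite /mix (negPf is_).
  by rewrite /mix inE eq_sym (negPf ik).
by rewrite /mix mem_head.
Qed.

(** * The multilinear form of a tensor and its contractions *)

Section Tensor.
Variables (R : realType) (I : finType) (V : I -> vectType R).
Variable ip : forall j, {dot (V j) for idfun}.
Implicit Types (x y z : forall i, V i) (T : tensor V).

(** This is the form tau: the inner product of T with [pure x]. *)
Definition tform T x : R :=
  \sum_(a : multi_index V) T a * \prod_i ip i (bvec (a i)) (x i).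

(** This is C_l. Its argument is a full family, so that the contractions for all [l] can be
    evaluated at the same points. *)
Definition contract T l x : V l :=
  \sum_(a : multi_index V)
    (T a * \prod_(i | i != l) ip i (bvec (a i)) (x i)) *: bvec (a l).

Lemma ip_contract T l x v : ip l (contract T l x) v = tform T (dfwith x v).
Proof.
rewrite linear_sumlz; apply: eq_bigr => a _; rewrite linearZl_LR /= -mulrA.
congr (_ * _); rewrite (bigD1 l (P := predT)) //= dfwith_in mulrC.
by congr (_ * _); apply: eq_bigr => i il; rewrite dfwith_out // eq_sym.
Qed.

Lemma ip_contractE T l x : ip l (contract T l x) (x l) = tform T x.
Proof. by rewrite ip_contract dfwith_id. Qed.

Lemma tform_multilinear T : multilinear (tform T : _ -> R^o).
Proof.
move=> x l c u v; rewrite -!ip_contract.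
by rewrite linearDr linearZr_LR.
Qed.

Lemma contract_linear T l x i : i != l ->
  linear (fun v : V i => contract T l (dfwith x v)).
Proof.
move=> il c u v; apply: (@dot_inj _ _ (ip l)) => t.
rewrite linearDl linearZl_LR /= !ip_contract !(dfwithC _ _ t il).
by rewrite tform_multilinear.
Qed.

Lemma tform_linear x : linear (fun T => tform T x : R^o).
Proof.
move=> c S T; rewrite scaler_sumr -big_split; apply: eq_bigr => a _ /=.
by rewrite !ffunE mulrDl -mulrA.
Qed.

Lemma tform_pure x y : tform (pure x) y = \prod_i ip i (x i) (y i).
Proof.
move: x; apply: (multilinear_eq (W := R^o)) => [x i c u v|x i c u v|a].
- by rewrite pure_multilinear tform_linear.
- rewrite !(bigD1 i (P := predT)) //= !dfwith_in linearDl linearZl_LR mulrDl /=.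
  rewrite -mulrA; congr (c * (_ * _) + _ * _);
    by apply: eq_bigr => j ji; rewrite !dfwith_out // eq_sym.
rewrite /tform (bigD1 a) //= [X in _ + X]big1 ?addr0 => [|b /negPf ba].
  by rewrite pure_bvec eqxx mul1r.
by rewrite pure_bvec ba mul0r.
Qed.

Lemma tform_sumZ (J : finType) (c : J -> R) (v : J -> forall i, V i) x :
  tform (\sum_j c j *: pure (v j)) x = \sum_j c j * \prod_i ip i (v j i) (x i).
Proof.
rewrite (linear_sumZ _ _ (tform_linear x)).
by apply: eq_bigr => j _; rewrite tform_pure.
Qed.

(** The vectors [r i k] representing the coordinate functionals form the dual basis; evaluating the
    form at them recovers the coefficients of the tensor. *)
Lemma tform_inj T T' : tform T =1 tform T' -> T = T'.
Proof.
have rP i (k : 'I_(\dim {:V i})) :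
    exists r, forall u, ip i r u = coord (vbasis {:V i}) k u.
  exact: (riesz (ip i) (coord (vbasis {:V i}) k)).
pose r i k := sval (cid (rP i k)).
have rE i k u : ip i (r i k) u = coord (vbasis {:V i}) k u.
  exact: (svalP (cid (rP i k))).
have coefE (S : tensor V) (a : multi_index V) : tform S (fun i => r i (a i)) = S a.
  rewrite /tform (bigD1 a) //= [X in _ + X]big1 ?addr0 => [|b ba].
    by rewrite big1 ?mulr1 // => i _; rewrite dotC rE coord_bvec eqxx.
  rewrite (eq_bigr (fun i => coord (vbasis {:V i}) (a i) (bvec (b i)))).
    have := pure_bvec b a; rewrite ffunE => ->.
    by rewrite eq_sym (negPf ba) mulr0.
  by move=> i _; rewrite dotC rE.
by move=> TT'; apply/ffunP => a; rewrite -coefE TT' coefE.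
Qed.
End Tensor.

(** * Pairing two-fold tensors with pairs of vectors *)

Section Pairing.
Variables (R : realType) (V : vectType R) (ip : {dot V for idfun}).

(** The inner product of A with [pure2 x y]. *)
Definition pairing (x y : V) (A : tensor2 V V) : R :=
  \sum_p \sum_q (A : 'M_(_, _)) p q * (ip (bvec p) x * ip (bvec q) y).

Lemma pairing_linear x y : linear (pairing x y : _ -> R^o).
Proof.
move=> c A B; rewrite scaler_sumr -big_split; apply: eq_bigr => p _ /=.
rewrite scaler_sumr -big_split; apply: eq_bigr => q _ /=.
by rewrite !mxE mulrDl -mulrA.
Qed.

Lemma pairing_pure2 x y u v : pairing x y (pure2 u v) = ip u x * ip v y.
Proof.
rewrite {2}(bvec_sum u) {2}(bvec_sum v) !linear_sumlz big_distrlr /=.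
apply: eq_bigr => p _; apply: eq_bigr => q _.
by rewrite mxE mulrACA !linearZl_LR.
Qed.

Lemma pairing_Sym2 x y (A : tensor2 V V) :
  A \in Sym2 V -> pairing x y A = pairing y x A.
Proof.
move=> /Sym2P AT; rewrite /pairing exchange_big; apply: eq_bigr => p _ /=.
by apply: eq_bigr => q _; rewrite -{1}AT mxE; congr (_ * _); rewrite mulrC.
Qed.
End Pairing.

(** * The symmetry condition as an exchange property; scaled decompositions *)

Section Star.
Variables (R : realType) (I : finType) (V : I -> vectType R).
Variable ip : forall j, {dot (V j) for idfun}.
Implicit Types (x y z : forall i, V i) (T : tensor V).

(** This translates statements about T *_l T into inner products of contractions: g is the inner
    product with the tensor product of the x_j ⊗ y_j over j != l. *)
Lemma star_pairing T l x y :
  exists g : {linear tensor (fun j : {j | j != l} =>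
                               tensor2 (V (val j)) (V (val j))) -> R^o},
    (forall A, g (pure A) =
       \prod_j pairing (ip (val j)) (x (val j)) (y (val j)) (A j)) /\
    g (star ip l T T) = ip l (contract ip T l x) (contract ip T l y).
Proof.
pose f (A : forall j : {j | j != l}, tensor2 (V (val j)) (V (val j))) : R^o :=
  \prod_j pairing (ip (val j)) (x (val j)) (y (val j)) (A j).
have [|g gP _] := @tensor_universal R _ _ R^o f.
  move=> A i c B C; rewrite /f !(bigD1 i (P := predT)) //= !dfwith_in.
  rewrite pairing_linear mulrDl -mulrA.
  congr (c * (_ * _) + _ * _);
    by apply: eq_bigr => j ji; rewrite !dfwith_out // eq_sym.
exists g; split=> //.
rewrite linear_sum linear_sumlz; apply: eq_bigr => a _.
rewrite linear_sum linear_sumr; apply: eq_bigr => b _.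
rewrite linearZ gP linearZl_LR linearZr_LR /=.
rewrite /f; under eq_bigr do rewrite pairing_pure2.
rewrite -(big_sub [pred j | j != l]
  (fun j => ip j (bvec (a j)) (x j) * ip j (bvec (b j)) (y j))) big_split /=.
set P := \prod_(i | _) _; set Q := \prod_(i | _) _.
rewrite [LHS](_ : _ = (T a * T b * ip l (bvec (a l)) (bvec (b l))) * (P * Q)) //.
ring.
Qed.

(** Swapping x_j and y_j affects only the factor j of the functional in [star_pairing], and a
    symmetric tensor pairs equally with (x_j, y_j) and (y_j, x_j). *)
Lemma contract_exchange T l :
  subtensor (fun j : {j | j != l} => Sym2 (V (val j))) (star ip l T T) ->
  forall j x y, j != l ->
  ip l (contract ip T l x) (contract ip T l y) =
  ip l (contract ip T l (dfwith x (y j))) (contract ip T l (dfwith y (x j))).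
Proof.
move=> [k [c [u [uS TE]]]] j x y jl.
have [g [gP <-]] := star_pairing T l x y.
have [g' [gP' <-]] := star_pairing T l (dfwith x (y j)) (dfwith y (x j)).
rewrite TE !linear_sum; apply: eq_bigr => m _; rewrite !linearZ gP gP'.
congr (c m * _); apply: eq_bigr => i _.
have [ji|ji] := eqVneq j (val i); last by rewrite !dfwith_out.
by subst j; rewrite !dfwith_in; apply: pairing_Sym2; apply: uS.
Qed.

(** Orthogonality in V_l kills the cross terms of T *_l T. The diagonal terms are multiples of
    tensor products of squares v ⊗ v, which are symmetric. *)
Lemma odeco_star T l : odeco ip T ->
  subtensor (fun j : {j | j != l} => Sym2 (V (val j))) (star ip l T T).
Proof.
move=> [k [v [_ v_orth ->]]].
exists k, (fun i => ip l (v i l) (v i l)).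
exists (fun i j => pure2 (v i (val j)) (v i (val j))).
split=> [i j|]; first by apply/Sym2P; rewrite tr_pure2.
have E : \sum_(i < k) pure (v i) = \sum_(i < k) 1 *: pure (v i).
  by apply: eq_bigr => i _; rewrite scale1r.
rewrite {1}E (linear_sumZ _ _ (star_linearl ip l _)); apply: eq_bigr => i _.
rewrite E (linear_sumZ _ _ (star_linearr ip l _)) (bigD1 i) //= big1 ?addr0.
  by rewrite !scale1r star_pure.
by move=> i' ii'; rewrite star_pure v_orth ?scale0r ?scaler0 // eq_sym.
Qed.

Lemma pure_eq0 x j : x j = 0 -> pure x = 0.
Proof.
by move=> xj; apply/ffunP => a; rewrite !ffunE (bigD1 j) //= xj linear0 mul0r.
Qed.

(** The scalars are absorbed into component p, and [P] keeps exactly the terms that do not vanish,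
    so that all remaining vectors are nonzero. *)
Lemma odeco_scaled (p : I) (k : nat) (c : 'I_k -> R)
    (v : 'I_k -> forall j, V j) (T : tensor V) :
  (forall j i1 i2, i1 != i2 -> ip j (v i1 j) (v i2 j) = 0) ->
  T = \sum_(i < k) c i *: pure (v i) -> odeco ip T.
Proof.
move=> v_orth ->.
pose P := [pred i | (c i != 0) && [forall j, v i j != 0]].
pose v' i := dfwith (v i) (c i *: v i p).
have pure_v' i : pure (v' i) = c i *: pure (v i).
  have := pure_multilinear (v i) (c i) (v i p) 0.
  by rewrite addr0 dfwith_id (@pure_eq0 (dfwith (v i) 0) p) ?dfwith_in ?addr0.
have v'E i j : exists2 d, v' i j = d *: v i j & (i \in P -> d != 0).
  have [<-|pj] := eqVneq p j.
    exists (c i); rewrite /v' ?dfwith_in //.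
    by rewrite inE => /andP[].
  by exists 1; rewrite /v' ?dfwith_out ?scale1r ?oner_eq0.
exists #|P|, (fun i => v' (enum_val i)); split.
- move=> i j; have [d -> d0] := v'E (enum_val i) j.
  have iP := enum_valP i; rewrite scaler_eq0 negb_or d0 //=.
  by move: iP; rewrite inE => /andP[_ /forallP/(_ j)].
- move=> j i1 i2 i12; have [d1 -> _] := v'E (enum_val i1) j.
  have [d2 -> _] := v'E (enum_val i2) j.
  rewrite linearZl_LR linearZr_LR /= v_orth ?mulr0 //.
  by rewrite (inj_eq enum_val_inj).
rewrite -(big_enum_val (fun i => pure (v' i))) [RHS]big_mkcond.
apply: eq_bigr => i _; case: ifPn; first by rewrite pure_v'.
rewrite inE negb_and negbK => /orP[/eqP->|]; first by rewrite scale0r.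
rewrite negb_forall => /existsP[j]; rewrite negbK => /eqP vij.
by rewrite (pure_eq0 vij) scaler0.
Qed.
End Star.

(** * From the exchange property to an orthogonal decomposition *)

Section Exchange.
Variables (R : realType) (I : finType) (V : I -> vectType R).
Variables (ip : forall j, {dot (V j) for idfun}) (T : tensor V).
Implicit Types x y z : forall i, V i.

Local Notation tau := (tform ip T).
Local Notation C := (contract ip T).

Hypothesis exchange : forall l j x y, j != l ->
  ip l (C l x) (C l y) = ip l (C l (dfwith x (y j))) (C l (dfwith y (x j))).

Definition slice p q (pq : q != p) x : {linear V q -> V p} :=
  HB.pack (fun v => C p (dfwith x v))
    (GRing.isLinear.Build R (V q) (V p) *:%R _ (contract_linear ip T x pq)).

Definition slicef p q (pq : q != p) x : 'Hom(V q, V p) := linfun (slice pq x).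

Lemma slicefE p q (pq : q != p) x v : slicef pq x v = C p (dfwith x v).
Proof. by rewrite lfunE. Qed.

(** Both sides are tau at x with v in component q and w in component p: slices in opposite
    directions are adjoint. *)
Lemma ip_slicef p q (pq : q != p) (qp : p != q) x v w :
  ip p (slicef pq x v) w = ip q v (slicef qp x w).
Proof. by rewrite [RHS]dotC !slicefE !ip_contract dfwithC. Qed.

(** Paired with t, the left side becomes an inner product of two values of C_q, at y with w and at x
    with t in component p. Exchanging component p swaps w and t. This supplies both symmetry
    hypotheses of [simultaneous_svd]. *)
Lemma slicefC p q (pq : q != p) (qp : p != q) x y w :
  slicef pq x (slicef qp y w) = slicef pq y (slicef qp x w).
Proof.
apply: (@dot_inj _ _ (ip p)) => t; rewrite !(ip_slicef pq qp) [RHS]dotC !slicefE.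
by rewrite (exchange _ _ qp) !dfwith_in !dfwith_twice dotC.
Qed.

Lemma exchange_odeco_pair (p q : I) : q != p -> odeco ip T.
Proof.
move=> qp; have pq : p != q by rewrite eq_sym.
have [k [u [w [[u0 u_orth w_orth uA] [uw AE]]]]] :=
  simultaneous_svd (fun x v w => ip_slicef qp pq x v w)
                   (@slicefC _ _ qp pq) (@slicefC _ _ pq qp).
have {uA} [xs xsP] := choice uA.
have w0 i : w i != 0.
  have [c cE] := uw i (xs i).
  by apply: contraNneq (xsP i) => w0; rewrite cE w0 scaler0.
pose rho i z := tau (dfwith (dfwith z (u i)) (w i)).
(* The left side is a multiple of w_i; pairing with w_i identifies the coefficient. *)
have rhoE i z : C p (dfwith z (u i)) = (rho i z / ip p (w i) (w i)) *: w i.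
  have [c cE] := uw i z; rewrite /rho -ip_contract -slicefE cE linearZl_LR /=.
  by rewrite mulfK // dot_eq0.
have tauE z : tau z =
    \sum_i rho i z / (ip q (u i) (u i) * ip p (w i) (w i)) *
           (ip q (u i) (z q) * ip p (w i) (z p)).
  rewrite -(ip_contractE _ _ p) -{1}(dfwith_id z q) -slicefE AE linear_sumlz.
  apply: eq_bigr => i _; rewrite slicefE rhoE scalerA linearZl_LR /=.
  by rewrite invfM; ring.
have rho_q i x (t : V q) : rho i (dfwith x t) = rho i x.
  by rewrite /rho dfwith_twice.
have rho_p i x (t : V p) : rho i (dfwith x t) = rho i x.
  by rewrite /rho (dfwithC _ _ _ pq) dfwith_twice.
(* Apply the exchange for l = p after placing u_i in component q of both families: all contractions
   involved are multiples of w_i, so their inner products are products of values of [rho i], divided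
   by |w_i|^2. *)
have rho_exchange i x y j :
    rho i x * rho i y = rho i (dfwith x (y j)) * rho i (dfwith y (x j)).
  have [<-|qj] := eqVneq q j; first by rewrite !rho_q.
  have [<-|pj] := eqVneq p j; first by rewrite !rho_p.
  have jp : j != p by rewrite eq_sym.
  have := exchange (dfwith x (u i)) (dfwith y (u i)) jp.
  rewrite !(dfwith_out _ _ qj) !(dfwithC _ _ _ qj) !rhoE.
  rewrite !linearZl_LR !linearZr_LR /=.
  have n0 : ip p (w i) (w i) != 0 by rewrite dot_eq0.
  rewrite !divfK // => E; apply: (mulIf (invr_neq0 n0)).
  by rewrite mulrAC E mulrAC.
(* A base point at which [rho i] is nonzero, as [exchange_factorization] requires. *)
pose y i := dfwith (dfwith (xs i) (u i)) (w i).
have yq i : y i q = u i by rewrite /y dfwith_out // dfwith_in.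
have yp i : y i p = w i by rewrite /y dfwith_in.
have rhoy i : rho i (y i) = tau (y i).
  by rewrite /rho -{1}(yq i) dfwith_id -{1}(yp i) dfwith_id.
have rhoy0 i : rho i (y i) != 0.
  rewrite rhoy /y; apply: contra (xsP i) => /eqP rho0.
  by rewrite slicefE rhoE [rho _ _]rho0 mul0r scale0r.
(* Outside p and q, the vector [C j (y i)] represents the linear form t |-> tau (y_i with t in
   component j), which is the j-th factor of [rho i] up to a scalar. *)
pose v i := dfwith (dfwith (fun j => C j (y i)) (u i)) (w i).
have vq i : v i q = u i by rewrite /v dfwith_out // dfwith_in.
have vp i : v i p = w i by rewrite /v dfwith_in.
have vj i j : q != j -> p != j -> v i j = C j (y i).
  by move=> qj pj; rewrite /v !dfwith_out.
have tau0 i i' z : i != i' -> z q = u i -> z p = w i' -> tau z = 0.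
  move=> ii' zq zp; rewrite tauE zq zp big1 // => m _.
  have [->|mi] := eqVneq m i; first by rewrite (w_orth i i' ii') !mulr0.
  by rewrite (u_orth m i mi) mul0r mulr0.
have v_orth j i i' : i != i' -> ip j (v i j) (v i' j) = 0.
  move=> ii'; have [<-|qj] := eqVneq q j; first by rewrite !vq u_orth.
  have [<-|pj] := eqVneq p j; first by rewrite !vp w_orth.
  (* Exchanging component p puts w_i' next to u_i in the first contraction, so the inner product
     becomes a value of tau that vanishes by [tau0]. *)
  rewrite !vj // (exchange _ _ pj) yp.
  rewrite ip_contract (tau0 i i') //.
    by rewrite dfwith_out 1?eq_sym // dfwith_out // yq.
  by rewrite dfwith_out 1?eq_sym // dfwith_in.
have rho_prod i : exists c, forall z, rho i z =
    c * \prod_(j | (j != q) && (j != p)) ip j (v i j) (z j).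
  (* The constant collects the denominators of the factorization; the factors at p and q equal 1
     because [rho i] is independent of these components. *)
  exists (rho i (y i) * \prod_(j | (j != q) && (j != p)) (rho i (y i))^-1) => z.
  rewrite (exchange_factorization (rho_exchange i) (rhoy0 i) z).
  rewrite -mulrA -big_split [in RHS]big_mkcond; congr (_ * _).
  apply: eq_bigr => j _ /=.
  have [->|jq] /= := eqVneq j q; first by rewrite rho_q divff.
  have [->|jp] /= := eqVneq j p; first by rewrite rho_p divff.
  rewrite mulrC vj 1?eq_sym // ip_contract; congr (_ * _).
  rewrite /rho (dfwithC _ _ _ jq) -{1}(yq i) dfwith_id.
  by rewrite (dfwithC _ _ _ jp) -{1}(yp i) dfwith_id.
have [c cE] := choice rho_prod.
pose c' i := c i / (ip q (u i) (u i) * ip p (w i) (w i)).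
apply: (odeco_scaled p (c := c') v_orth); apply: (@tform_inj _ _ _ ip) => z.
rewrite tform_sumZ tauE; apply: eq_bigr => i _.
rewrite [in RHS](bigD1 q) //= [in RHS](bigD1 p) //= vq vp cE.
by rewrite /c'; ring.
Qed.

Lemma exchange_odeco (p : I) : odeco ip T.
Proof.
have [[q]|noq] := pselect (exists q, q != p); first exact: exchange_odeco_pair.
have allp i : i = p by apply/eqP/negPn/negP => ip'; apply: noq; exists i.
(* With p as the only index there is nothing to contract, and [C p] returns T itself as a vector. If
   T = 0, [odeco_scaled] drops this single term. *)
pose v (_ : 'I_1) j := C j (fun=> 0).
apply: (odeco_scaled p (c := fun=> 1) (v := v)) => [j i1 i2|].
  by rewrite !ord1.
apply: (@tform_inj _ _ _ ip) => z; rewrite tform_sumZ big_ord1 mul1r.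
rewrite (bigD1 p) //= big1 => [|i]; last by rewrite (allp i) eqxx.
rewrite mulr1 ip_contract; congr (tform _ _).
apply: functional_extensionality_dep => j.
by rewrite (allp j) dfwith_in.
Qed.
End Exchange.

Theorem theorem9 (R : realType) (d : nat) (hd : (0 < d)%N)
    (V : 'I_d -> vectType R) (ip : forall j : 'I_d, {dot (V j) for idfun})
    (T : tensor V) :
  odeco ip T <->
  forall l : 'I_d,
    subtensor (fun j : {j : 'I_d | j != l} => Sym2 (V (val j)))
      (star ip l T T).
Proof.
split=> [oT l|symT]; first exact: odeco_star.
apply: (exchange_odeco (ip := ip) _ (Ordinal hd)) => l j x y.
exact: contract_exchange.
Qed.
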